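(* If $q\equiv 2$ or $4\pmod 6$, then $N(4,q,1)=\dfrac{q^2(q+2)}{4}$.
   Context: $B_q=\{0,\dots,q-1\}$ and $B_q^4$ is the set of words of length 4 over $B_q$. $N(4,q,1)$ is the maximum cardinality of a code $C\subseteq B_q^4$ capable of correcting single deletions, i.e. such that the sets $\lfloor x\rfloor_1$ ($x\in C$) of words obtained from $x$ by deleting one letter are pairwise disjoint (equivalently, the minimum deletion–insertion distance between distinct codewords exceeds 2). *)

(* Defs.v *)
From mathcomp Require Import all_boot.
Set Implicit Arguments. Unset Strict Implicit. Unset Printing Implicit Defensive.

Definition deletions1 (T : eqType) (s : seq T) : seq (seq T) :=
  [seq take i s ++ drop i.+1 s | i <- iota 0 (size s)].

Definition single_deletion_code (n q : nat) (C : {set n.-tuple 'I_q}) : Prop :=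
  forall x y, x \in C -> y \in C -> x != y ->
    forall w, w \in deletions1 (tval x) -> w \notin deletions1 (tval y).

Definition is_N1 (n q m : nat) : Prop :=
  (exists C : {set n.-tuple 'I_q}, single_deletion_code C /\ #|C| = m) /\
  (forall C : {set n.-tuple 'I_q}, single_deletion_code C -> #|C| <= m).

(* Main.v *)
Require Import Defs.
From mathcomp Require Import all_boot.
From mathcomp Require Import zify.
Set Implicit Arguments. Unset Strict Implicit. Unset Printing Implicit Defensive.

(** Upper bound.  Give the words of length 3 the weights aaa: 4, aab and abb: 2,
abc: 1, aba: 0.  The distinct deletions of a word of length 4 have total weight
at least 4, except for the words abca, where it is 2.  For fixed a, the pairs
{b, c} of the codewords abca are disjoint subsets of the q - 1 letters other
than a; as q - 1 is odd there are at most (q - 2) / 2 of them, and summing up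
gives 4 |C| <= q (q^2 + q + 2) + q (q - 2) = q^2 (q + 2).

Construction.  For equality it suffices to take all words aaaa and aabb, and a
set of words abca and abcd whose deletions partition the words abc and all the
words aba but one for each a.  Let q = 2n and see a letter as a height in Z/n
with a binary label.  The words abcd with four distinct heights are taken on
the solutions of a + b = c + d in Z/n, that is, on the trapezoids inscribed in
a regular n-gon: a triangle extends to three trapezoids, each of which takes
care of two of the six orders of its vertices, in a way depending on the labels
and the cyclic order.  A trapezoid degenerates when one vertex is the midpoint
of the two others; depending on the labels, it is then replaced by a word abca
or by words that contain both letters of the height of the midpoint.  The words
aba that stay uncovered are those whose two letters have the same height. *)

(** * The upper bound *)

Section Packing.
Variable T : finType.

(** Deletions are kept as triples, which form a finite type over which weights can be summed. *)
Definition del3 (s : seq T) : seq (T * T * T) :=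
  if s is [:: a; b; c; d] then [:: (b, c, d); (a, c, d); (a, b, d); (a, b, c)]
  else [::].

Definition tripleseq (t : T * T * T) : seq T := [:: t.1.1; t.1.2; t.2].

Lemma tuple4P (x : 4.-tuple T) : exists a b c d, x = [tuple a; b; c; d].
Proof.
case/tupleP: x => a x; case/tupleP: x => b x; case/tupleP: x => c x.
case/tupleP: x => d x; exists a, b, c, d.
by rewrite (tuple0 x); apply: val_inj.
Qed.

Lemma mem_del3 (x : 4.-tuple T) t :
  (t \in del3 x) = (tripleseq t \in deletions1 (tval x)).
Proof.
have [a [b [c [d ->]]]] := tuple4P x; case: t => [[u v] w].
by rewrite /deletions1 /tripleseq /= !inE !xpair_eqE !eqseq_cons !eqxx !andbT !andbA.
Qed.

Lemma deletions1_tripleseq (x : 4.-tuple T) w : w \in deletions1 (tval x) ->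
  exists t, w = tripleseq t.
Proof.
have [a [b [c [d ->]]]] := tuple4P x.
rewrite /deletions1 /= !inE => /or4P[] /eqP->.
- by exists (b, c, d).
- by exists (a, c, d).
- by exists (a, b, d).
- by exists (a, b, c).
Qed.

Lemma sum_del3 (s : seq T) (f : T * T * T -> nat) :
  \sum_(t <- undup (del3 s)) f t = \sum_(t in del3 s) f t.
Proof.
by rewrite big_uniq ?undup_uniq //=; apply: eq_bigl => t; rewrite mem_undup.
Qed.

Lemma sum_del3_exchange (C : {set 4.-tuple T}) (f : T * T * T -> nat) :
  \sum_(x in C) \sum_(t <- undup (del3 x)) f t =
  \sum_t #|[set x in C | t \in del3 x]| * f t.
Proof.
under eq_bigr => x _ do rewrite sum_del3.
rewrite (exchange_big_dep predT) //=; apply: eq_bigr => t _.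
by rewrite -sum_nat_const; apply: eq_bigl => x; rewrite inE.
Qed.
End Packing.

(** A triple is a deletion of at most one codeword, so after exchanging the sums each [f t] is
    counted at most once. *)
Lemma code_packing q (C : {set 4.-tuple 'I_q}) f : single_deletion_code C ->
  \sum_(x in C) \sum_(t <- undup (del3 x)) f t <= \sum_t f t.
Proof.
move=> codeC; rewrite sum_del3_exchange; apply: leq_sum => t _.
rewrite -[leqRHS]mul1n leq_mul2r; apply/orP; right.
apply/card_le1_eqP => x y; rewrite !inE !mem_del3 => /andP[xC xt] /andP[yC yt].
apply: contraTeq yt; rewrite eq_sym => nxy; exact: (codeC x y xC yC nxy _ xt).
Qed.

(* The upper bound takes g = 0; the construction takes g a b = 1 when aba has to be covered. *)
Definition weight (T : eqType) (g : T -> T -> nat) (t : T * T * T) : nat :=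
  let: (a, b, c) := t in
  if a == b then if b == c then 4 else 2 else
  if b == c then 2 else if a == c then g a b else 1.

Lemma sum_triples (T : finType) (f : T * T * T -> nat) :
  \sum_t f t = \sum_a \sum_b \sum_c f (a, b, c).
Proof. by rewrite pair_bigA pair_bigA /=; apply: eq_bigr => -[[]]. Qed.

(** With q letters and [a] fixed, [b = a] contributes 4 + 2(q - 1), and each other [b] contributes 2
    + (q - 2) + [g a b]. *)
Lemma sum_weight (T : finType) (g : T -> T -> nat) :
  \sum_t weight g t =
  #|T| * (#|T| ^ 2 + #|T| + 2) + \sum_a \sum_(b | b != a) g a b.
Proof.
rewrite sum_triples -[#|T| * _]sum_nat_const -big_split /=.
apply: eq_bigr => a _; rewrite (bigD1 a) //=.
have Tgt0 : 0 < #|T| by apply/card_gt0P; exists a.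
have -> : \sum_c weight g (a, a, c) = 4 + 2 * #|T|.-1.
  rewrite (bigD1 a) //= !eqxx; congr (_ + _).
  rewrite (eq_bigr (fun=> 2)) ?sum_nat_const ?cardC1 1?mulnC // => c.
  by rewrite eq_sym => /negPf->.
rewrite (eq_bigr (fun b => #|T| + g a b)) => [|b nba].
  rewrite big_split /= sum_nat_const cardC1 addnA; congr (_ + _).
  by case: #|T| Tgt0 => // m _ /=; nia.
rewrite (bigD1 a) //= (bigD1 b) //= !eqxx.
rewrite eq_sym (negPf nba) (eq_bigr (fun=> 1)) => [|c /andP[nca ncb]].
  rewrite sum1_card; have := cardD1 a (predC1 b); have := cardC1 b.
  rewrite (_ : #|[predD1 predC1 b & a]| = #|[pred i | i != a & i != b]|); last exact: eq_card.
  rewrite !inE eq_sym nba => ->; move: #|[pred i | _ & _]| => k.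
  by case: #|T| Tgt0 => // m _ /= ->; lia.
by rewrite eq_sym (negPf ncb) eq_sym (negPf nca).
Qed.

Definition return_word (T : eqType) (s : seq T) : bool :=
  if s is [:: a; b; c; d] then [&& a == d, a != b, a != c & b != c] else false.

Local Ltac decide_eqs := repeat match goal with H : is_true (?x != ?y) |- _ =>
  progress rewrite ?(negPf H) ?[y == x]eq_sym ?(negPf H) end; rewrite /= ?eqxx //=.

(** The deletions bca, aca, aba, abc of a word abca weigh 1, 0, 0, 1; the last term makes up this
    deficit of 2. *)
Lemma weight_word_ge4 (T : finType) (x : 4.-tuple T) :
  4 <= \sum_(t <- undup (del3 x)) weight (fun _ _ => 0) t + 2 * return_word x.
Proof.
have [a [b [c [d ->]]]] := tuple4P x.
rewrite /= !inE !xpair_eqE.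
case: (eqVneq a b) => [?|ab]; case: (eqVneq b c) => [?|bc];
case: (eqVneq c d) => [?|cd]; case: (eqVneq a c) => [?|ac];
case: (eqVneq b d) => [?|bd]; case: (eqVneq a d) => [?|ad]; subst;
  rewrite ?eqxx //=; decide_eqs; rewrite ?big_cons ?big_nil /weight ?eqxx; decide_eqs.
all: done.
Qed.

(** A word abca uses up the two distinct triples aba and aca. *)
Lemma return_word_weight (T : finType) (x : 4.-tuple T) a :
  2 * (return_word x && (thead x == a)) <=
  \sum_(t <- undup (del3 x)) [&& t.1.1 == a, t.2 == a & t.1.2 != a].
Proof.
have [b [c [d [e ->]]]] := tuple4P x; rewrite theadE /=.
case: (eqVneq b e) => //= <-; case: (eqVneq b c) => //= bc.
case: (eqVneq b d) => //= bd; case: (eqVneq c d) => //= cd.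
case: (eqVneq b a) => // <-; rewrite !inE !xpair_eqE; decide_eqs.
by rewrite !big_cons big_nil /= !eqxx; decide_eqs.
Qed.

Lemma code_return_words q (C : {set 4.-tuple 'I_q}) : ~~ odd q ->
  single_deletion_code C ->
  2 * #|[set x in C | return_word x]| <= q * (q - 2).
Proof.
move=> q_even codeC.
rewrite -sum1_card big_distrr /= (partition_big (fun x : 4.-tuple 'I_q => thead x) predT) //=.
have -> : q * (q - 2) = \sum_(a < q) (q - 2) by rewrite sum_nat_const card_ord.
apply: leq_sum => a _.
set S := (X in X <= _).
(* As [q.-1] is odd, parity improves the packing bound [q.-1] to [q - 2]. *)
have S_even : ~~ odd S by rewrite /S -big_distrr /= mul2n odd_double.
suff S_le : S <= q.-1 by lia.
have -> : q.-1 = \sum_(t : 'I_q * 'I_q * 'I_q) [&& t.1.1 == a, t.2 == a & t.1.2 != a].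
  rewrite sum_triples (bigD1 a) //= [X in _ + X]big1 ?addn0; last first.
    by move=> b /negPf-> /=; rewrite big1 // => c _; rewrite big1.
  rewrite eqxx /= -{1}[q]card_ord -(cardC1 a) -sum1_card big_mkcond /=.
  apply: eq_bigr => b _; rewrite (bigD1 a) //= eqxx big1 ?addn0 //=.
  by move=> c /negPf->.
apply: leq_trans (code_packing _ codeC).
rewrite /S big_mkcond [leqRHS]big_mkcond; apply: leq_sum => x _.
rewrite inE; case: (x \in C) => //=.
by apply: leq_trans (return_word_weight x a); case: ifP.
Qed.

Lemma code_upper_bound q (C : {set 4.-tuple 'I_q}) : ~~ odd q ->
  single_deletion_code C -> 4 * #|C| <= q ^ 2 * (q + 2).
Proof.
move=> q_even codeC.
have le1 := code_packing (weight (fun _ _ => 0)) codeC.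
rewrite sum_weight card_ord [X in _ + X]big1 ?addn0 in le1 => [|a _]; last exact: big1.
have le2 := code_return_words q_even codeC.
apply: (@leq_trans (q * (q ^ 2 + q + 2) + q * (q - 2))); last first.
  (* Truncation of [q - 2] is harmless at q = 0, where both sides vanish, and q = 1 is excluded by
     parity. *)
  by case: q {C codeC le1 le2} q_even => [|[|m]] // _; nia.
apply: leq_trans (leq_add le1 le2).
rewrite -sum1_card -[X in _ <= _ + 2 * X]sum1_card !big_distrr /=.
rewrite [X in _ <= _ + X](eq_bigl (fun x => (x \in C) && return_word x));
  last by move=> x; rewrite inE.
rewrite [X in _ <= _ + X]big_mkcondr -big_split /=; apply: leq_sum => x _.
by have := weight_word_ge4 x; case: (return_word x).
Qed.

(** * The construction *)

(* Congruence modulo n, for sums of two residues below n. *)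
Definition eqm (n s t : nat) : bool := [|| s == t, s == t + n | s + n == t].
(** Strict cyclic order on the vertices of the n-gon: going up from [a], one meets [b] before
    [c]. *)
Definition cyc (a b c : nat) : bool := [|| a < b < c, b < c < a | c < a < b].
(* Height and label. *)
Definition letter : Type := (nat * bool)%type.

(* The table was found by computer search.  Labels 0010 and 1011 give the words
   abca; words with two letters of equal height replace degenerate trapezoids or
   cover the words over two letters of one height and one of another. *)
Definition inner_word (n : nat) (x y z t : letter) : bool :=
  let: (a, i) := x in let: (b, j) := y in let: (c, k) := z in let: (d, l) := t in
  let trapezoid := [&& a != b, a != c, a != d, c != d & eqm n (a + b) (c + d)] in
  let midpoint := [&& a == d, a != b & eqm n (b + c) (a + a)] in
  match i, j, k, l with
  | false, true, false, true =>
      [|| trapezoid, [&& a == d, b == c & a != b]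
        | [&& a == b, c == d & ~~ eqm n (a + a) (c + c)]]
  | true, true, false, false =>
      trapezoid && ((a < b) == (c < d))
      || [&& a == d, b == c, a != b & eqm n (a + a) (b + b)]
  | false, false, false, false | true, true, true, true =>
      [&& trapezoid, cyc b a c & cyc b c d]
  | false, false, true, false | true, false, true, true => midpoint
  | true, false, false, false =>
      [&& a == b, eqm n (c + d) (a + a) & cyc a c d]
      || [&& a == d, eqm n (b + c) (a + a) & cyc a c b]
  | true, true, true, false =>
      [&& c == d, eqm n (a + b) (c + c) & cyc c b a]
      || [&& a == d, eqm n (b + c) (a + a) & cyc a b c]
  | _, _, _, _ => false
  end.

Lemma eqmE n s t : eqm n s t -> s = t \/ s = t + n \/ s + n = t.
Proof. by case/or3P => /eqP ->; [left | right; left | right; right]. Qed.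

Lemma cycE a b c : cyc a b c -> (a < b /\ b < c) \/ (b < c /\ c < a) \/ (c < a /\ a < b).
Proof. by case/or3P => /andP[? ?]; [left | right; left | right; right]. Qed.

(* Small goals: lia is given only the relevant facts, which keeps its certificates short. *)
Local Ltac split_hyps := repeat match goal with
  | H : is_true (_ && _) |- _ => let H1 := fresh in let H2 := fresh in case/andP: H => H1 H2
  | H : is_true (_ || _) |- _ => case/orP: H => H
  | H : is_true (@eq_op _ (?a : nat) ?b) |- _ => move/eqP: H => H; subst
  | H : is_true (~~ (@eq_op _ (?a : nat) ?b)) |- _ => move/eqP: H => H
  end.
Local Ltac use_eqm := repeat match goal with
  | H : is_true (cyc _ _ _) |- _ => clear H
  | H : is_true (~~ cyc _ _ _) |- _ => clear H
  | H : is_true (eqm _ _ _) |- _ => apply eqmE in H end.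
Local Ltac use_cyc := repeat match goal with
  | H : is_true (eqm _ _ _) |- _ => clear H
  | H : is_true (~~ eqm _ _ _) |- _ => clear H
  | H : ?a <> ?b :> nat |- _ => clear H
  | H : is_true (cyc _ _ _) |- _ => apply cycE in H end.
Local Ltac use_all := repeat match goal with
  | H : is_true (eqm _ _ _) |- _ => apply eqmE in H
  | H : is_true (cyc _ _ _) |- _ => apply cycE in H
  end; unfold eqm, cyc in *.
Local Ltac fin := first [ by [] | use_cyc; lia | use_eqm; lia | use_all; lia ].

Lemma cyc_rot a b c : cyc a b c = cyc b c a.
Proof. by rewrite /cyc; lia. Qed.

Lemma cyc_total a b c : a <> b -> b <> c -> a <> c -> cyc a b c \/ cyc a c b.
Proof. by rewrite /cyc; lia. Qed.

(* Parallel chords of a regular n-gon do not cross. *)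
Lemma trapezoid_cyc n a b c u : eqm n (u + a) (b + c) ->
  cyc a b c -> cyc a b u -> a < n -> b < n -> c < n -> u < n -> cyc u b c.
Proof.
by move=> /eqmE E /cycE[|[|]] [? ?] /cycE[|[|]] [? ?] ? ? ? ?; rewrite /cyc; lia.
Qed.

Local Ltac use_lt := repeat match goal with
  | H : is_true (cyc _ _ _) |- _ => clear H
  | H : is_true (eqm _ _ _) |- _ => clear H
  | H : is_true (~~ eqm _ _ _) |- _ => clear H
  | H : is_true (_ < _) |- _ => clear H
  end.
Local Ltac atom := first [ by [] | by rewrite cyc_rot | by rewrite 2!cyc_rot
  | by apply: trapezoid_cyc; eassumption
  | use_eqm; rewrite /eqm; lia | use_lt; lia ].
Local Ltac prove := match goal with
  | |- is_true (_ && _) => apply/andP; split; prove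
  | |- is_true (_ || _) => apply/orP; first [left; prove | right; prove]
  | _ => atom
  end.
Local Ltac arith := cbv beta zeta iota delta [inner_word]; prove.

(** Separates the inner words from aaaa and aabb: every deletion of the latter has two equal
    consecutive letters, and no deletion of an inner word has. *)
Lemma inner_word_neq n x y z t : x.1 < n -> y.1 < n -> z.1 < n -> t.1 < n ->
  inner_word n x y z t -> [&& x != y, y != z, z != t, x != z & y != t].
Proof.
case: x y z t => [a i] [b j] [c k] [d l] /= an bn cn dn.
case: i; case: j; case: k; case: l; cbv beta zeta iota delta [inner_word]; try by [].
all: rewrite !xpair_eqE /= ?andbT ?andbF /=; move=> H; split_hyps; try by [].
all: repeat (apply/andP; split); try by [].
all: fin.
Qed.

(** * Existence of a letter extending a word of length 3 *)

Lemma fourth_height n a b c : a < n -> b < n -> c < n ->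
  exists2 v, v < n & eqm n (v + a) (b + c).
Proof.
(* The residue of b + c - a, according to whether this is negative, below n, or at least n. *)
move=> an bn cn; exists (if b + c < a then b + c + n - a
  else if b + c - a < n then b + c - a else b + c - a - n); rewrite /eqm;
  by do !case: ifP; lia.
Qed.

Definition insertion n (x y z v : letter) : bool :=
  [|| inner_word n v x y z, inner_word n x v y z, inner_word n x y v z | inner_word n x y z v].

Local Ltac insert1 v := exists v; [by [] | apply/or4P; apply: Or41; arith].
Local Ltac insert2 v := exists v; [by [] | apply/or4P; apply: Or42; arith].
Local Ltac insert3 v := exists v; [by [] | apply/or4P; apply: Or43; arith].
Local Ltac insert4 v := exists v; [by [] | apply/or4P; apply: Or44; arith].
Local Ltac on_cyc a b c := have [?|?] : cyc a b c \/ cyc a c b by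
  apply: cyc_total; use_eqm; lia.
Local Ltac on_eq a b := case: (eqVneq a b) => [?|/eqP ?].

(** One case per label pattern. The heights [u], [v], [w] are opposite to [a], [b], [c] in the three
    trapezoids: u + a = b + c, v + b = a + c, w + c = a + b. If [u = a], then [a] is the midpoint of
    [b] and [c], and a letter of height [a] is inserted; likewise for [v = b] and [w = c]. *)
Lemma inner_word_insertion n (x y z : letter) : x.1 < n -> y.1 < n -> z.1 < n ->
  x != y -> y != z -> ~~ ((x == z) && (x.1 == y.1)) ->
  exists2 v : letter, v.1 < n & insertion n x y z v.
Proof.
case: x y z => [a i] [b j] [c k] /= an bn cn.
case: i; case: j; case: k; rewrite !xpair_eqE /= ?andbT ?andbF => ab bc ac;
  repeat match goal with H : is_true (~~ (_ == _)) |- _ => move/eqP: H => H end.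
- on_eq a c.
    have [v vn] := fourth_height bn an cn => ?.
    by insert2 (v, false).
  on_cyc a b c.
    have [u un] := fourth_height an bn cn => ?.
    on_eq u a; first by insert4 (a, false).
    on_cyc a u b; first by insert1 (u, true).
    by insert2 (u, true).
  have [w wn wE] := fourth_height cn bn an.
  on_eq w c; first by insert4 (c, false).
  on_cyc b c w; first by insert4 (w, true).
  (* [w] and [c] lie on the same side of the parallel chord [ab], so they see its ends in the same
     order. *)
  have ? : cyc w b a by apply: (trapezoid_cyc wE) => //; atom.
  by insert3 (w, true).
- on_eq a c.
    have [v vn] := fourth_height bn an cn => ?.
    on_eq v b; first by insert3 (b, false).
    on_cyc a v b; first by insert2 (v, true).
    by insert3 (v, true).
  on_eq b c.
    have [u un] := fourth_height an bn cn => ?.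
    on_eq u a; first by insert4 (a, false).
    on_cyc b a u; first by insert1 (u, true).
    by insert2 (u, true).
  have [w wn] := fourth_height cn an bn => ?.
  on_eq w c.
    on_cyc c a b; first by insert1 (c, true).
    by insert3 (c, true).
  (* Label 1100 requires both parallel sides to be traversed in the same linear direction; this
     fixes the order of [w] and [c]. *)
  case: (boolP ((a < b) == (w < c))) => ?; first by insert3 (w, false).
  by insert4 (w, false).
- on_eq a b; first by insert1 (c, false).
  on_eq a c.
    have [v vn] := fourth_height bn an cn => ?.
    by insert3 (v, true).
  on_eq b c.
    case: (boolP (eqm n (a + a) (b + b))) => ?; first by insert4 (a, true).
    by insert1 (a, false).
  have [u un] := fourth_height an bn cn => ?.
  on_eq u a; first by insert4 (a, true).
  by insert1 (u, false).
- on_eq a b.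
    have [w wn] := fourth_height cn an bn => ?.
    on_eq w c; first by insert1 (c, true).
    on_cyc a w c; first by insert3 (w, false).
    by insert4 (w, false).
  on_eq a c.
    have [v vn] := fourth_height bn an cn => ?.
    on_eq v b; first by insert2 (b, true).
    on_cyc a b v; first by insert2 (v, false).
    by insert3 (v, false).
  have [u un] := fourth_height an bn cn => ?.
  on_eq u a.
    on_cyc a b c; first by insert2 (a, false).
    by insert4 (a, false).
  case: (boolP ((u < a) == (b < c))) => ?; first by insert1 (u, true).
  by insert2 (u, true).
- on_eq a b.
    case: (boolP (eqm n (a + a) (c + c))) => ?; first by insert1 (c, true).
    by insert3 (c, false).
  on_eq a c; first by insert3 (b, false).
  have [w wn] := fourth_height cn an bn => ?.
  on_eq w c; first by insert1 (c, true).
  by insert3 (w, false).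
- on_eq a b.
    case: (boolP (eqm n (a + a) (c + c))) => ?; first by insert1 (c, false).
    by insert4 (c, true).
  on_eq a c.
    have [v vn] := fourth_height bn an cn => ?.
    by insert2 (v, false).
  on_eq b c; first by insert4 (a, true).
  have [w wn] := fourth_height cn an bn => ?.
  on_eq w c; first by insert1 (c, false).
  by insert4 (w, true).
- on_eq a c; first by insert2 (b, true).
  on_eq b c.
    case: (boolP (eqm n (a + a) (b + b))) => ?; first by insert4 (a, false).
    by insert2 (a, true).
  have [u un] := fourth_height an bn cn => ?.
  on_eq u a; first by insert4 (a, false).
  by insert2 (u, true).
- on_eq a c.
    have [v vn] := fourth_height bn an cn => ?.
    by insert3 (v, true).
  on_cyc a b c.
    have [u un] := fourth_height an bn cn => ?.
    on_eq u a; first by insert1 (a, true).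
    on_cyc a u b; first by insert1 (u, false).
    by insert2 (u, false).
  have [w wn wE] := fourth_height cn bn an.
  on_eq w c; first by insert1 (c, true).
  on_cyc b c w; first by insert4 (w, false).
  have ? : cyc w b a by apply: (trapezoid_cyc wE) => //; atom.
  by insert3 (w, false).
Qed.

(** * Uniqueness of the letter and of its position *)

Lemma inner_word_same_position n x y z v v' :
  x.1 < n -> y.1 < n -> z.1 < n -> v.1 < n -> v'.1 < n ->
  [|| inner_word n v x y z && inner_word n v' x y z,
      inner_word n x v y z && inner_word n x v' y z,
      inner_word n x y v z && inner_word n x y v' z | inner_word n x y z v && inner_word n x y z v'] ->
  v = v'.
Proof.
case: x y z v v' => [a i] [b j] [c k] [d l] [d' l'] /= an bn cn dn dn'.
case/or4P => /andP[];
  case: i; case: j; case: k; case: l; case: l'; cbv beta zeta iota delta [inner_word]; try by [].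
all: move=> H H'; apply: f_equal2 => //; split_hyps; try by [].
all: fin.
Qed.

(** With the previous lemma, this makes each word of length 3 a deletion of at most one inner
    word. *)
Lemma inner_word_other_position n x y z v v' :
  x.1 < n -> y.1 < n -> z.1 < n -> v.1 < n -> v'.1 < n ->
  [|| inner_word n v x y z && inner_word n x v' y z, inner_word n v x y z && inner_word n x y v' z,
      inner_word n v x y z && inner_word n x y z v', inner_word n x v y z && inner_word n x y v' z,
      inner_word n x v y z && inner_word n x y z v'
    | inner_word n x y v z && inner_word n x y z v'] ->
  False.
Proof.
case: x y z v v' => [a i] [b j] [c k] [d l] [d' l'] /= an bn cn dn dn' H.
case/orP: H => [|/orP[|/orP[|/or3P[]]]] => /andP[];
  case: i; case: j; case: k; case: l; case: l'; cbv beta zeta iota delta [inner_word]; try by [].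
all: move=> H H'; split_hyps; try by [].
all: fin.
Qed.

(** * The perfect code over 2n letters *)

Section Code.
Variable n : nat.
Notation q := n.*2.

Definition dec (x : 'I_q) : letter := (x./2, odd x).

Lemma dec_inj : injective dec.
Proof.
move=> x y [xy oxy]; apply: val_inj.
by rewrite /= -[val x]odd_double_half -[val y]odd_double_half xy oxy.
Qed.

Lemma dec_height x : (dec x).1 < n.
Proof. by rewrite /= ltn_half_double. Qed.

Lemma dec_surj (v : letter) : v.1 < n -> exists x, dec x = v.
Proof.
case: v => [h l] /= hn; have hq : l + h.*2 < q by lia.
exists (Ordinal hq); rewrite /dec /= half_bit_double oddD odd_double addbF.
by case: l hq.
Qed.

Definition codeword (s : seq 'I_q) : bool :=
  if s is [:: a; b; c; d] then
    (a == b) && (c == d) || inner_word n (dec a) (dec b) (dec c) (dec d)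
  else false.

Lemma codeword_neq a b c d : inner_word n (dec a) (dec b) (dec c) (dec d) ->
  [/\ a != b, b != c, c != d, a != c & b != d].
Proof.
by move/inner_word_neq; rewrite !dec_height => /(_ isT isT isT isT) /and5P[];
  rewrite !(inj_eq dec_inj).
Qed.

Local Ltac pick p p' := first [exact: introT andP (conj p p')
  | apply/orP; first [left; exact: introT andP (conj p p') | right; pick p p']].

Lemma codeword_unique (s s' : seq 'I_q) t :
  codeword s -> codeword s' -> t \in del3 s -> t \in del3 s' -> s = s'.
Proof.
case: s => [|a [|b [|c [|d [|//]]]]] //; case: s' => [|a' [|b' [|c' [|d' [|//]]]]] //.
rewrite /codeword => /orP[/andP[/eqP <- /eqP <-]|ps] /orP[/andP[/eqP <- /eqP <-]|ps'].
- by rewrite /= !inE => /or4P[] /eqP-> /or4P[] /eqP[] *; subst.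
- have [ab bc cd ac bd] := codeword_neq ps'.
  by rewrite /= !inE => /or4P[] /eqP-> /or4P[] /eqP[] *; subst;
    rewrite !eqxx in ab bc cd ac bd.
- have [ab bc cd ac bd] := codeword_neq ps.
  by rewrite /= !inE => /or4P[] /eqP-> /or4P[] /eqP[] *; subst;
    rewrite !eqxx in ab bc cd ac bd.
case: t => [[x y] z]; have hx := dec_height x; have hy := dec_height y.
have hz := dec_height z.
rewrite /= !inE => /or4P[] /eqP[xE yE zE] /or4P[] /eqP[xE' yE' zE'];
  rewrite -{}xE -{}yE -{}zE in ps *; rewrite -{}xE' -{}yE' -{}zE' in ps' *.
(* Among the 4 x 4 pairs of deleted positions, the diagonal ones share the position. *)
1,6,11,16: by congr [:: _; _; _; _]; apply: dec_inj;
  apply: (inner_word_same_position hx hy hz (dec_height _) (dec_height _)); rewrite ps ps' ?orbT.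
all: exfalso.
(* Pairs above the diagonal; below it the two words exchange roles. *)
1-3,5,6,9: by apply: (inner_word_other_position hx hy hz (dec_height _) (dec_height _));
  pick ps ps'.
all: by apply: (inner_word_other_position hx hy hz (dec_height _) (dec_height _));
  pick ps' ps.
Qed.

(** Weight 0 exempts exactly the words aba whose two distinct letters share a height. *)
Lemma codeword_cover (t : 'I_q * 'I_q * 'I_q) :
  0 < weight (fun a b : 'I_q => a./2 != b./2) t ->
  exists2 x : 4.-tuple 'I_q, codeword x & t \in del3 x.
Proof.
case: t => [[a b] c]; rewrite /weight.
case: (eqVneq a b) => [<- _|ab].
  by exists [tuple a; a; c; c]; [rewrite /= !eqxx | rewrite !inE eqxx ?orbT].
case: (eqVneq b c) => [<- _|bc].
  by exists [tuple a; a; b; b]; [rewrite /= !eqxx | rewrite !inE eqxx ?orbT].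
move=> ac.
have [] := @inner_word_insertion n _ _ _ (dec_height a) (dec_height b) (dec_height c).
- by rewrite (inj_eq dec_inj).
- by rewrite (inj_eq dec_inj).
- by rewrite (inj_eq dec_inj) negb_and; case: (eqVneq a c) ac => //= _; rewrite lt0b.
move=> v /dec_surj[u <-] /or4P[] patu.
- by exists [tuple u; a; b; c]; [exact: introT orP (or_intror patu) | rewrite !inE eqxx ?orbT].
- by exists [tuple a; u; b; c]; [exact: introT orP (or_intror patu) | rewrite !inE eqxx ?orbT].
- by exists [tuple a; b; u; c]; [exact: introT orP (or_intror patu) | rewrite !inE eqxx ?orbT].
- by exists [tuple a; b; c; u]; [exact: introT orP (or_intror patu) | rewrite !inE eqxx ?orbT].
Qed.

(** aaaa has the one deletion aaa of weight 4, aabb has two of weight 2, and an inner word at most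
    four of weight at most 1. *)
Lemma codeword_weight (x : 4.-tuple 'I_q) : codeword x ->
  \sum_(t <- undup (del3 x)) weight (fun a b : 'I_q => a./2 != b./2) t <= 4.
Proof.
have [a [b [c [d ->]]]] := tuple4P x; rewrite [codeword _]/=.
case/orP => [/andP[/eqP <- /eqP <-]|/codeword_neq[ab bc cd ac bd]].
  case: (eqVneq a c) => [<-|ac]; rewrite /= !inE !xpair_eqE !eqxx /=.
    by rewrite big_seq1 /= !eqxx.
  by decide_eqs; rewrite !big_cons big_nil /weight !eqxx; decide_eqs.
rewrite sum_del3; apply: (@leq_trans (\sum_(t in del3 [:: a; b; c; d]) 1)).
  apply: leq_sum => t; rewrite /= !inE => /or4P[] /eqP->;
    rewrite /weight; decide_eqs; by case: ifP => // _; exact: leq_b1.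
by rewrite sum1_card; apply: leq_trans (card_size _) _.
Qed.

Definition perfect_code : {set 4.-tuple 'I_q} := [set x : 4.-tuple 'I_q | codeword x].

Lemma perfect_code_correcting : single_deletion_code perfect_code.
Proof.
move=> x y; rewrite !inE => cx cy nxy w wx; apply: contra nxy => wy.
have [t wE] := deletions1_tripleseq wx; rewrite wE -!mem_del3 in wx wy.
by apply/eqP/val_inj; apply: codeword_unique wx wy.
Qed.

(** All positive weight is covered and no codeword carries more than 4, so four times the size is at
    least the total weight. *)
Lemma perfect_code_card : q ^ 2 * (q + 2) <= 4 * #|perfect_code|.
Proof.
pose g (a b : 'I_q) : nat := a./2 != b./2.
apply: (@leq_trans (\sum_t weight g t)).
  rewrite sum_weight card_ord.
  apply: (@leq_trans (q * (q ^ 2 + q + 2) + q * (q - 2))); first by nia.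
  rewrite leq_add2l.
  have -> : q * (q - 2) = \sum_(a < q) (q - 2) by rewrite sum_nat_const card_ord.
  apply: leq_sum => a _.
  have -> : \sum_(b | b != a) g a b = \sum_b g a b.
    by rewrite [RHS](bigD1 a) //= /g eqxx.
  pose A := [set b : 'I_q | a./2 == b./2].
  (* Letters of one height are told apart by their label, so at least [q - 2] letters [b] have
     [g a b = 1]. *)
  have A2 : #|A| <= 2.
    rewrite -card_bool -(@card_in_imset _ _ (fun b : 'I_q => odd b)) ?max_card //.
    move=> b c; rewrite !inE => /eqP ab /eqP ac obc.
    by apply: dec_inj; rewrite /dec -ab -ac obc.
  have -> : \sum_b g a b = #|~: A|.
    rewrite -sum1_card [RHS]big_mkcond; apply: eq_bigr => b _.
    by rewrite !inE /g; case: eqP.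
  by have := cardsC A; rewrite card_ord; lia.
rewrite mulnC -sum_nat_const.
apply: leq_trans (_ : \sum_(x in perfect_code) \sum_(t <- undup (del3 x)) weight g t <= _).
  rewrite sum_del3_exchange; apply: leq_sum => t _.
  case: (posnP (weight g t)) => [->//|/codeword_cover[x cx tx]].
  by rewrite leq_pmull //; apply/card_gt0P; exists x; rewrite !inE cx.
by apply: leq_sum => x; rewrite inE => /codeword_weight.
Qed.
End Code.

Theorem theorem3p4 (q : nat) (hq : (q %% 6 == 2) || (q %% 6 == 4)) :
  is_N1 4 q (q ^ 2 * (q + 2) %/ 4).
Proof.
have q_even : ~~ odd q by lia.
have upper (C : {set 4.-tuple 'I_q}) : single_deletion_code C ->
    #|C| <= q ^ 2 * (q + 2) %/ 4.
  by move=> codeC; rewrite leq_divRL // mulnC; apply: code_upper_bound.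
split=> //; have := odd_double_half q; rewrite (negPf q_even) => qE.
rewrite -{}qE in upper *; exists (perfect_code q./2).
split; first exact: perfect_code_correcting.
apply/eqP; rewrite eqn_leq upper; last exact: perfect_code_correcting.
by rewrite -[#|_|](@mulKn _ 4) // leq_div2r // perfect_code_card.
Qed.
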